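(* Let $J=\{\mathbf{s}\}$, $K=\{\mathbf{i}_n,\mathbf{j}_n:n>0\}$ and $I=J\cup K$ (sets of morphisms of $\mathrm{Gph}$). Then $\mathrm{Gph}$ has a cofibrantly-generated model structure with acyclic cofibrations generated by $J$ and cofibrations generated by $I$, and with weak equivalences $\mathcal{W}=K^\dagger$.
   Context: A graph is $X=(X_0,X_1,s,t)$ with a set $X_0$ of nodes, a set $X_1$ of arcs, and functions $s,t:X_1\to X_0$ (source, target). A graph morphism $f:X\to Y$ is a pair $f_0:X_0\to Y_0$, $f_1:X_1\to Y_1$ with $s f_1=f_0 s$, $t f_1=f_0 t$. This is the category $\mathrm{Gph}$; $\mathbf{0}$ is the empty graph. $\mathbf{A}$ is the graph with two nodes $0,1$ and one arc from $0$ to $1$; $\mathbf{D}$ is the subgraph with the one node $0$ and no arcs; $\mathbf{s}:\mathbf{D}\to\mathbf{A}$ is the inclusion. For $n>0$, the cycle graph $\mathbf{C}_n$ has $\mathbb{Z}/n$ as nodes and as arcs, with $s(i)=i+1$, $t(i)=i$; $\mathbf{i}_n:\mathbf{0}\to\mathbf{C}_n$ is the unique morphism and $\mathbf{j}_n:\mathbf{C}_n+\mathbf{C}_n\to\mathbf{C}_n$ is the codiagonal (fold) morphism. $\ell\dagger r$ means every commutative square with left side $\ell$ and right side $r$ has a diagonal filler; $\mathcal{F}^\dagger=\{r:f\dagger r\ \forall f\in\mathcal{F}\}$, ${}^\dagger\mathcal{F}=\{\ell:\ell\dagger f\ \forall f\in\mathcal{F}\}$. A weak factorization system is a pair $(\mathcal{L},\mathcal{R})$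 with $\mathcal{L}^\dagger=\mathcal{R}$, $\mathcal{L}={}^\dagger\mathcal{R}$, such that every morphism factors as $r\circ\ell$ with $\ell\in\mathcal{L}$, $r\in\mathcal{R}$. A model structure on a category with finite limits and colimits is a triple $(\mathcal{C},\mathcal{W},\mathcal{F})$ of classes of morphisms (cofibrations, weak equivalences, fibrations) such that (1) if two of $a,b,a\circ b$ are in $\mathcal{W}$ so is the third; (2) $(\underline{\mathcal{C}},\mathcal{F})$ is a weak factorization system, where $\underline{\mathcal{C}}=\mathcal{C}\cap\mathcal{W}$ (acyclic cofibrations); (3) $(\mathcal{C},\underline{\mathcal{F}})$ is a weak factorization system, where $\underline{\mathcal{F}}=\mathcal{W}\cap\mathcal{F}$ (acyclic fibrations). It is cofibrantly generated, with $I$ generating the cofibrations and $J$ generating the acyclic cofibrations, if $I,J$ are sets with $J^\dagger=\mathcal{F}$ and $I^\dagger=\underline{\mathcal{F}}$, so that $\mathcal{C}={}^\dagger(I^\dagger)$ and $\underline{\mathcal{C}}={}^\dagger(J^\dagger)$. (The usual smallness conditions are automatic in $\mathrm{Gph}$.) *)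

(* Defs.v *)
(* The category Gph of directed graphs, lifting properties, weak factorization
   systems and cofibrantly generated model structures (MathComp style). *)
From mathcomp Require Import all_boot.
From mathcomp Require Import boolp.

Set Implicit Arguments.
Unset Strict Implicit.
Unset Printing Implicit Defensive.

(* One fixed universe of small sets: hom-sets, nodes, arcs and the index types
   of sets of morphisms live in it, while objects of a category need not. *)
Definition small := Type.

Record category_laws (ob : Type) (hom : ob -> ob -> Type)
    (id : forall X, hom X X)
    (comp : forall X Y Z, hom Y Z -> hom X Y -> hom X Z) : Prop := CategoryLaws {
  law_idl : forall X Y (f : hom X Y), comp X Y Y (id Y) f = f;
  law_idr : forall X Y (f : hom X Y), comp X X Y f (id X) = f;
  law_assoc : forall X Y Z T (h : hom Z T) (g : hom Y Z) (f : hom X Y),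
    comp X Z T h (comp X Y Z g f) = comp X Y T (comp Y Z T h g) f }.

Record category := Category {
  obj :> Type;
  hom : obj -> obj -> small;
  idm : forall X, hom X X;
  compose : forall X Y Z, hom Y Z -> hom X Y -> hom X Z;
  cat_laws : category_laws idm compose }.

Arguments hom {c} X Y.
Arguments idm {c} X.
Arguments compose {c X Y Z} g f.
Notation "g \oc f" := (compose g f) (at level 40, left associativity).

Record fin_category := FinCategory {
  fobj :> finType;
  fhom : fobj -> fobj -> finType;
  fidm : forall s, fhom s s;
  fcompose : forall s t u, fhom t u -> fhom s t -> fhom s u;
  fcat_laws : category_laws (hom := fun s t => fhom s t) fidm fcompose }.

Arguments fhom {f} s t.
Arguments fidm {f} s.
Arguments fcompose {f s t u} v w.

Record diagram (S : fin_category) (C : category) := Diagram {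
  diag_obj :> S -> C;
  diag_mor : forall s t : S, fhom s t -> hom (diag_obj s) (diag_obj t);
  diag_id : forall s, diag_mor (fidm s) = idm (diag_obj s);
  diag_comp : forall s t u (v : fhom t u) (w : fhom s t),
    diag_mor (fcompose v w) = diag_mor v \oc diag_mor w }.

Section Limits.
Variables (S : fin_category) (C : category) (D : diagram S C).

Definition is_cone (X : C) (p : forall s, hom X (D s)) : Prop :=
  forall s t (u : fhom s t), diag_mor D u \oc p s = p t.

Definition is_limit (X : C) (p : forall s, hom X (D s)) : Prop :=
  is_cone p /\
  forall (Y : C) (q : forall s, hom Y (D s)), is_cone q ->
    exists! h : hom Y X, forall s, p s \oc h = q s.

Definition is_cocone (X : C) (p : forall s, hom (D s) X) : Prop :=
  forall s t (u : fhom s t), p t \oc diag_mor D u = p s.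

Definition is_colimit (X : C) (p : forall s, hom (D s) X) : Prop :=
  is_cocone p /\
  forall (Y : C) (q : forall s, hom (D s) Y), is_cocone q ->
    exists! h : hom X Y, forall s, h \oc p s = q s.

End Limits.

Definition has_finite_limits (C : category) : Prop :=
  forall (S : fin_category) (D : diagram S C),
    exists (X : C) (p : forall s, hom X (D s)), is_limit p.

Definition has_finite_colimits (C : category) : Prop :=
  forall (S : fin_category) (D : diagram S C),
    exists (X : C) (p : forall s, hom (D s) X), is_colimit p.

Record arrow (C : category) := Arrow {
  dom : C;
  cod : C;
  mor :> hom dom cod }.

Arguments Arrow {C dom cod} mor.

Definition arrow_class (C : category) := arrow C -> Prop.

Section Classes.
Variable C : category.
Implicit Types A B F L R W I J : arrow_class C.

Definition eq_class A B : Prop := forall a, A a <-> B a.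
Definition cap_class A B : arrow_class C := fun a => A a /\ B a.
Definition cup_class A B : arrow_class C := fun a => A a \/ B a.

Definition is_set A : Prop :=
  exists (T : small) (a : T -> arrow C), forall f, A f <-> exists t, a t = f.

Definition lifts (l r : arrow C) : Prop :=
  forall (f : hom (dom l) (dom r)) (g : hom (cod l) (cod r)),
    r \oc f = g \oc l ->
    exists h : hom (cod l) (dom r), h \oc l = f /\ r \oc h = g.

Definition rlp F : arrow_class C := fun r => forall f, F f -> lifts f r.
Definition llp F : arrow_class C := fun l => forall f, F f -> lifts l f.

Record weak_factorization_system L R : Prop := WFS {
  wfs_rlp : eq_class (rlp L) R;
  wfs_llp : eq_class L (llp R);
  wfs_factor : forall (X Y : C) (f : hom X Y),
    exists (Z : C) (l : hom X Z) (r : hom Z Y),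
      [/\ L (Arrow l), R (Arrow r) & f = r \oc l] }.

Record two_of_three W : Prop := TwoOfThree {
  tot_comp : forall (X Y Z : C) (a : hom Y Z) (b : hom X Y),
    W (Arrow a) -> W (Arrow b) -> W (Arrow (a \oc b));
  tot_left : forall (X Y Z : C) (a : hom Y Z) (b : hom X Y),
    W (Arrow b) -> W (Arrow (a \oc b)) -> W (Arrow a);
  tot_right : forall (X Y Z : C) (a : hom Y Z) (b : hom X Y),
    W (Arrow a) -> W (Arrow (a \oc b)) -> W (Arrow b) }.

Record is_model_structure (Cof W Fib : arrow_class C) : Prop := ModelStructure {
  ms_limits : has_finite_limits C;
  ms_colimits : has_finite_colimits C;
  ms_two_of_three : two_of_three W;
  ms_wfs_acyclic_cof :
    weak_factorization_system (cap_class Cof W) Fib;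
  ms_wfs_acyclic_fib :
    weak_factorization_system Cof (cap_class W Fib) }.

(* I generates the cofibrations and J the acyclic cofibrations; the classes of
   cofibrations and acyclic cofibrations are then determined by the two weak
   factorization systems. *)
Record cofibrantly_generated I J W Fib : Prop := CofibrantlyGenerated {
  cg_set_I : is_set I;
  cg_set_J : is_set J;
  cg_fib : eq_class (rlp J) Fib;
  cg_acyclic_fib : eq_class (rlp I) (cap_class W Fib) }.

End Classes.

Record graph := Graph {
  node : small;
  arc : small;
  src : arc -> node;
  tgt : arc -> node }.

Record graph_hom (X Y : graph) := GraphHom {
  on_node : node X -> node Y;
  on_arc : arc X -> arc Y;
  hom_src : forall a, src (on_arc a) = on_node (src a);
  hom_tgt : forall a, tgt (on_arc a) = on_node (tgt a) }.

Lemma graph_hom_eq (X Y : graph) (f g : graph_hom X Y) :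
  on_node f = on_node g -> on_arc f = on_arc g -> f = g.
Proof.
case: f g => [f0 f1 fs ft] [g0 g1 gs gt] /= e0 e1.
case: g0 / e0 gs gt; case: g1 / e1 => gs gt.
by congr GraphHom; exact: Prop_irrelevance.
Qed.

Definition graph_id (X : graph) : graph_hom X X :=
  @GraphHom X X id id (fun=> erefl) (fun=> erefl).

Definition graph_comp (X Y Z : graph) (g : graph_hom Y Z) (f : graph_hom X Y) :
    graph_hom X Z :=
  @GraphHom X Z (fun x => on_node g (on_node f x)) (fun a => on_arc g (on_arc f a))
    (fun a => etrans (hom_src g (on_arc f a)) (congr1 (on_node g) (hom_src f a)))
    (fun a => etrans (hom_tgt g (on_arc f a)) (congr1 (on_node g) (hom_tgt f a))).

Lemma graph_laws : category_laws graph_id graph_comp.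
Proof. by split=> *; apply: graph_hom_eq. Qed.

Definition Gph : category := Category graph_laws.

Definition empty_graph : Gph :=
  @Graph void void (fun a : void => a) (fun a : void => a).

Definition from_empty (X : Gph) : hom empty_graph X :=
  @GraphHom empty_graph X
    (fun x : void => match x with end) (fun a : void => match a with end)
    (fun a : void => match a with end) (fun a : void => match a with end).

(* The nodes 0 and 1 are encoded as false and true. *)
Definition graph_A : Gph :=
  @Graph bool unit (fun=> false) (fun=> true).

Definition graph_D : Gph :=
  @Graph unit void (fun a : void => match a with end)
    (fun a : void => match a with end).

Definition mor_s : hom graph_D graph_A :=
  @GraphHom graph_D graph_A (fun=> false) (fun a : void => match a with end)
    (fun a : void => match a with end) (fun a : void => match a with end).

(* Z/n is 'I_n, and ordS i is i + 1 modulo n. *)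
Definition cycle_graph (n : nat) : Gph :=
  @Graph 'I_n 'I_n (fun i => ordS i) (fun i => i).

Definition sum_graph (X Y : Gph) : Gph :=
  @Graph (node X + node Y)%type (arc X + arc Y)%type
    (fun a => match a with inl b => inl (src b) | inr b => inr (src b) end)
    (fun a => match a with inl b => inl (tgt b) | inr b => inr (tgt b) end).

Definition codiagonal (X : Gph) : hom (sum_graph X X) X :=
  @GraphHom (sum_graph X X) X
    (fun x => match x with inl y => y | inr y => y end)
    (fun a => match a with inl b => b | inr b => b end)
    (fun a => match a with inl _ => erefl | inr _ => erefl end)
    (fun a => match a with inl _ => erefl | inr _ => erefl end).

Definition mor_i (n : nat) : hom empty_graph (cycle_graph n) :=
  from_empty (cycle_graph n).

Definition mor_j (n : nat) :
    hom (sum_graph (cycle_graph n) (cycle_graph n)) (cycle_graph n) :=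
  codiagonal (cycle_graph n).

Definition gen_J : arrow_class Gph := fun a => a = Arrow mor_s.

Definition gen_K : arrow_class Gph := fun a =>
  exists n : nat, 0 < n /\ (a = Arrow (mor_i n) \/ a = Arrow (mor_j n)).

Definition gen_I : arrow_class Gph := cup_class gen_J gen_K.

(* Main.v *)
From mathcomp Require Import all_boot.
From mathcomp Require Import boolp.
Require Import Defs.

Set Implicit Arguments.
Unset Strict Implicit.
Unset Printing Implicit Defensive.

(** The class K^dagger consists of the morphisms along which every closed walk
    lifts uniquely, hence it satisfies two-of-three. Growing out-trees on a graph
    creates no closed walk, so the evident factorization into a tree extension
    followed by a fibration has its first factor in K^dagger; as every morphism
    of the saturation of J is a retract of such an extension, and K^dagger is
    closed under retracts, these are all weak equivalences. A K-factorization of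
    f : X -> Y adds to X every closed walk of Y and then divides by the least
    congruence that identifies the closed walks of the quotient having the same
    image in Y. *)

(** * Recognition of model structures *)

Section Recognition.
Variable C : category.
Implicit Types A B I J K W : arrow_class C.

Lemma compA (X Y Z T : C) (h : hom Z T) (g : hom Y Z) (f : hom X Y) :
  h \oc (g \oc f) = h \oc g \oc f.
Proof. exact: (law_assoc (cat_laws C)). Qed.

Lemma comp1m (X Y : C) (f : hom X Y) : idm Y \oc f = f.
Proof. exact: (law_idl (cat_laws C)). Qed.

Lemma compm1 (X Y : C) (f : hom X Y) : f \oc idm X = f.
Proof. exact: (law_idr (cat_laws C)). Qed.

Lemma rlpS A B r : (forall a, A a -> B a) -> rlp B r -> rlp A r.
Proof. by move=> sAB Br a /sAB; apply: Br. Qed.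

Lemma llpS A B l : (forall a, A a -> B a) -> llp B l -> llp A l.
Proof. by move=> sAB Bl a /sAB; apply: Bl. Qed.

Lemma llp_comp A (X Y Z : C) (g : hom Y Z) (f : hom X Y) :
  llp A (Arrow g) -> llp A (Arrow f) -> llp A (Arrow (g \oc f)).
Proof.
move=> Ag Af r Ar u v /= e.
have [|h [hf rh]] := Af r Ar u (v \oc g); first by rewrite /= e compA.
have [k [/= kg rk]] := Ag r Ar h v rh.
by exists k; split=> //=; rewrite compA kg hf.
Qed.

(** The retract argument: filling the square with top [l] and bottom the identity yields [h], which
    exhibits [f] as a retract of [l] under the fixed object [X]. *)
Lemma lifts_retract (X Y Z : C) (f : hom X Y) (l : hom X Z) (r : hom Z Y) :
  f = r \oc l -> lifts (Arrow f) (Arrow r) ->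
  exists2 h : hom Y Z, h \oc f = l & r \oc h = idm Y.
Proof.
move=> e /(_ l (idm Y))[|h [hf rh]]; first by rewrite /= comp1m.
by exists h.
Qed.

Lemma llp_retract A (X Y Z : C) (f : hom X Y) (l : hom X Z) (r : hom Z Y) :
  f = r \oc l -> lifts (Arrow f) (Arrow r) ->
  llp A (Arrow l) -> llp A (Arrow f).
Proof.
move=> e /(lifts_retract e)[/= h hf rh] Al a Aa u v /= eq_sq.
have [|k [/= kl ak]] := Al a Aa u (v \oc r); first by rewrite /= eq_sq e compA.
exists (k \oc h); split; first by rewrite /= -compA hf.
by rewrite /= compA ak -compA rh compm1.
Qed.

(** Right lifting classes are closed under retracts too. Since [f] is a retract of the first factor
    [l], being a weak equivalence passes from [l] to [f]. *)
Lemma rlp_retract A (X Y Z : C) (f : hom X Y) (l : hom X Z) (r : hom Z Y) :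
  f = r \oc l -> lifts (Arrow f) (Arrow r) ->
  rlp A (Arrow l) -> rlp A (Arrow f).
Proof.
move=> e /(lifts_retract e)[/= h hf rh] Al a Aa u v /= eq_sq.
have [|k [/= ka lk]] := Al a Aa u (h \oc v).
  by rewrite /= -compA -eq_sq compA hf.
exists k; split=> //=.
by rewrite e -compA lk compA rh comp1m.
Qed.

Definition factors A B : Prop :=
  forall (X Y : C) (f : hom X Y), exists (Z : C) (l : hom X Z) (r : hom Z Y),
    [/\ A (Arrow l), B (Arrow r) & f = r \oc l].

Lemma rlp_cup A B : eq_class (rlp (cup_class A B)) (cap_class (rlp B) (rlp A)).
Proof.
move=> r; split=> [ABr|[Br Ar] a [/Ar|/Br]] //.
by split; apply: rlpS ABr => a; [right|left].
Qed.

(* A K-then-J factorization is a factorization for J together with K: by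
   two-of-three the last factor is again a weak equivalence. *)
Lemma model_structure_of_rlp J K :
  has_finite_limits C -> has_finite_colimits C ->
  two_of_three (rlp K) ->
  factors (cap_class (llp (rlp J)) (rlp K)) (rlp J) ->
  factors (llp (rlp K)) (rlp K) ->
  is_model_structure (llp (rlp (cup_class J K))) (rlp K) (rlp J).
Proof.
move=> limC colimC W23 facJ facK; set I := cup_class J K.
have IE := @rlp_cup J K.
have J_cof l : llp (rlp J) l -> llp (rlp I) l by apply: llpS => a /IE[].
have K_cof l : llp (rlp K) l -> llp (rlp I) l by apply: llpS => a /IE[].
(* If [f] is an acyclic cofibration, two-of-three puts [r] in [rlp I], so [f] lifts against [r] and
   is a retract of [l]. Conversely, an [f] in [llp (rlp J)] lifts against [r] and inherits [rlp K]
   from [l] as its retract. *)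
have acycE : eq_class (cap_class (llp (rlp I)) (rlp K)) (llp (rlp J)).
  move=> [X Y f]; have [Z [l [r [[Jl Wl] Jr e]]]] := facJ X Y f.
  split=> [[If Wf]|Jf]; last first.
    by split; [exact: J_cof|exact: (rlp_retract e (Jf _ Jr))].
  have Wr : rlp K (Arrow r) by apply: (tot_left W23 Wl); rewrite -e.
  by apply: (llp_retract e) Jl; apply/If/IE.
split=> //; split.
- move=> r; split=> [Lr a Ja|Jr a /acycE]; last exact.
  by apply: Lr; apply/acycE => b; apply.
- exact: acycE.
- move=> X Y f; have [Z [l [r [[Jl Wl] Jr e]]]] := facJ X Y f.
  by exists Z, l, r; split=> //; apply/acycE.
- move=> r; split=> [Lr|/IE Ir a]; last exact.
  by apply/IE => a Ia; apply: Lr => b; apply.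
- move=> l; split; first by apply: llpS => a /IE.
  by apply: llpS => a /IE.
move=> X Y f; have [Z [k [r [Kk Wr ->]]]] := facK X Y f.
have [T [l [p [[Jl Wl] Jp e]]]] := facJ Z Y r.
exists T, (l \oc k), p; split; last by rewrite e compA.
- by apply: llp_comp; [exact: J_cof|exact: K_cof].
by split=> //; apply: (tot_left W23 Wl); rewrite -e.
Qed.

End Recognition.

(** * Quotients of graphs *)

Section Quotient.
Variables (T : Type) (R : T -> T -> Prop).

(** An element is an equivalence class taken as a predicate, so that equality of classes reduces to
    extensionality of predicates. *)
Definition quot := {P : T -> Prop | exists x, P = R x}.

Definition class (x : T) : quot := exist _ (R x) (ex_intro _ x erefl).

Lemma class_surj (z : quot) : exists x, class x = z.
Proof.
by case: z => P [x e]; exists x; apply: eq_exist.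
Qed.

Definition repr (z : quot) : T := projT1 (cid (class_surj z)).

Lemma reprK z : class (repr z) = z.
Proof. exact: projT2 (cid (class_surj z)). Qed.

Hypothesis eqR : RelationClasses.Equivalence R.

Lemma classP x y : class x = class y <-> R x y.
Proof.
case: eqR => rR sR tR; split=> [/(congr1 (@proj1_sig _ _)) /= ->|Rxy].
  exact: rR.
apply: eq_exist; apply: funext => z; apply: propext; split; last exact: tR.
by apply: tR; apply: sR.
Qed.

Lemma repr_class x : R (repr (class x)) x.
Proof. by apply/classP; rewrite reprK. Qed.

End Quotient.

Lemma graph_homP (X Y : graph) (f g : graph_hom X Y) :
  on_node f =1 on_node g -> on_arc f =1 on_arc g -> f = g.
Proof. by move=> /funext e0 /funext e1; apply: graph_hom_eq. Qed.

Lemma on_node_eq (X Y : graph) (f g : graph_hom X Y) :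
  f = g -> forall x, on_node f x = on_node g x.
Proof. by move=> ->. Qed.

Lemma on_arc_eq (X Y : graph) (f g : graph_hom X Y) :
  f = g -> forall a, on_arc f a = on_arc g a.
Proof. by move=> ->. Qed.

Section Congruence.
Variable X : graph.

Record congruence (R0 : node X -> node X -> Prop) (R1 : arc X -> arc X -> Prop)
  : Prop := Congruence {
  congr_node : RelationClasses.Equivalence R0;
  congr_arc : RelationClasses.Equivalence R1;
  congr_src : forall a b, R1 a b -> R0 (src a) (src b);
  congr_tgt : forall a b, R1 a b -> R0 (tgt a) (tgt b) }.

Lemma congruence_kernel (Y : graph) (g : graph_hom X Y) :
  congruence (fun x y => on_node g x = on_node g y)
             (fun a b => on_arc g a = on_arc g b).
Proof.
split; try by [split=> // x y z -> ->].
- by move=> a b e; rewrite -!hom_src e.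
- by move=> a b e; rewrite -!hom_tgt e.
Qed.

(** This serves to cut a generated congruence down by the kernel of a morphism; minimality then
    shows that the morphism factors through the quotient. *)
Lemma congruenceI R0 R1 S0 S1 : congruence R0 R1 -> congruence S0 S1 ->
  congruence (fun x y => R0 x y /\ S0 x y) (fun a b => R1 a b /\ S1 a b).
Proof.
move=> [[rR0 sR0 tR0] [rR1 sR1 tR1] srcR tgtR].
move=> [[rS0 sS0 tS0] [rS1 sS1 tS1] srcS tgtS].
split=> [||a b [/srcR ? /srcS]|a b [/tgtR ? /tgtS]] //; split; try by [].
- by move=> x y [/sR0 ? /sS0].
- by move=> x y z [Rxy Sxy] [/(tR0 _ _ _ Rxy) ? /(tS0 _ _ _ Sxy)].
- by move=> x y [/sR1 ? /sS1].
- by move=> x y z [Rxy Sxy] [/(tR1 _ _ _ Rxy) ? /(tS1 _ _ _ Sxy)].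
Qed.

Section Generated.
Variable P : (node X -> node X -> Prop) -> (arc X -> arc X -> Prop) -> Prop.

(** The intersection of all congruences satisfying [P]. Whether it satisfies [P] in turn depends on
    [P] and is settled separately. *)
Definition gen_node x y := forall R0 R1, congruence R0 R1 -> P R0 R1 -> R0 x y.
Definition gen_arc a b := forall R0 R1, congruence R0 R1 -> P R0 R1 -> R1 a b.

Lemma congruence_gen : congruence gen_node gen_arc.
Proof.
split=> [||a b ab R0 R1 cR PR|a b ab R0 R1 cR PR].
- split=> [x R0 R1 [[]] //|x y xy R0 R1 cR PR|x y z xy yz R0 R1 cR PR].
    by case: (cR) => -[_ sR _] _ _ _; apply: sR; apply: xy PR.
  by case: (cR) => -[_ _ tR] _ _ _; apply: (tR _ y); [apply: xy PR|apply: yz PR].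
- split=> [x R0 R1 [_ []] //|x y xy R0 R1 cR PR|x y z xy yz R0 R1 cR PR].
    by case: (cR) => _ [_ sR _] _ _; apply: sR; apply: xy PR.
  by case: (cR) => _ [_ _ tR] _ _; apply: (tR _ y); [apply: xy PR|apply: yz PR].
- by apply: (congr_src cR); apply: ab PR.
by apply: (congr_tgt cR); apply: ab PR.
Qed.

End Generated.

Variables (R0 : node X -> node X -> Prop) (R1 : arc X -> arc X -> Prop).
Hypothesis congR : congruence R0 R1.

Definition quotient_graph : graph :=
  @Graph (quot R0) (quot R1) (fun z => class R0 (src (repr z)))
    (fun z => class R0 (tgt (repr z))).

Lemma class_src a : src (class R1 a : arc quotient_graph) = class R0 (src a).
Proof.
apply/(classP (congr_node congR))/(congr_src congR).
exact: (repr_class (congr_arc congR)).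
Qed.

Lemma class_tgt a : tgt (class R1 a : arc quotient_graph) = class R0 (tgt a).
Proof.
apply/(classP (congr_node congR))/(congr_tgt congR).
exact: (repr_class (congr_arc congR)).
Qed.

Definition quotient_map : graph_hom X quotient_graph :=
  @GraphHom X quotient_graph (class R0) (class R1) class_src class_tgt.

Lemma quotient_factor (Y : graph) (g : graph_hom X Y) :
  (forall x y, R0 x y -> on_node g x = on_node g y) ->
  (forall a b, R1 a b -> on_arc g a = on_arc g b) ->
  exists h : graph_hom quotient_graph Y, graph_comp h quotient_map = g.
Proof.
move=> g0 g1.
have g0E x : on_node g (repr (class R0 x)) = on_node g x.
  exact/g0/(repr_class (congr_node congR)).
have g1E a : on_arc g (repr (class R1 a)) = on_arc g a.
  exact/g1/(repr_class (congr_arc congR)).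
pose h0 (z : node quotient_graph) := on_node g (repr z).
pose h1 (z : arc quotient_graph) := on_arc g (repr z).
have hs z : src (h1 z) = h0 (src z) by rewrite /h0 g0E hom_src.
have ht z : tgt (h1 z) = h0 (tgt z) by rewrite /h0 g0E hom_tgt.
by exists (GraphHom hs ht); apply: graph_homP.
Qed.

Lemma quotient_epi (Y : graph) (h k : graph_hom quotient_graph Y) :
  graph_comp h quotient_map = graph_comp k quotient_map -> h = k.
Proof.
move=> e; apply: graph_homP => z; rewrite -(reprK z).
  exact: (on_node_eq e (repr z)).
exact: (on_arc_eq e (repr z)).
Qed.

End Congruence.

(** * Finite limits and colimits of graphs *)

Section Limits.
Variables (S : fin_category) (D : diagram S Gph).

Let Dhom s t (u : fhom s t) : graph_hom (D s) (D t) := diag_mor D u.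

Definition limit_node (x : forall s, node (D s)) : Prop :=
  forall s t (u : fhom s t), on_node (Dhom u) (x s) = x t.

Definition limit_arc (a : forall s, arc (D s)) : Prop :=
  forall s t (u : fhom s t), on_arc (Dhom u) (a s) = a t.

Lemma limit_arc_src a : limit_arc a -> limit_node (fun s => src (a s)).
Proof. by move=> Da s t u; rewrite -hom_src Da. Qed.

Lemma limit_arc_tgt a : limit_arc a -> limit_node (fun s => tgt (a s)).
Proof. by move=> Da s t u; rewrite -hom_tgt Da. Qed.

Definition limit_graph : graph :=
  @Graph {x | limit_node x} {a | limit_arc a}
    (fun a => exist limit_node _ (limit_arc_src (svalP a)))
    (fun a => exist limit_node _ (limit_arc_tgt (svalP a))).

Definition limit_proj (s : S) : graph_hom limit_graph (D s) :=
  @GraphHom limit_graph (D s) (fun x => sval x s) (fun a => sval a s)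
    (fun=> erefl) (fun=> erefl).

(** Limits are computed separately on nodes and on arcs, as compatible families. *)
Lemma limit_graphP : @is_limit S Gph D limit_graph limit_proj.
Proof.
split=> [s t u|Y q qD].
  by apply: graph_homP => -[x Dx]; apply: Dx.
have q0 y : limit_node (fun s => on_node (q s) y).
  by move=> s t u; rewrite -(qD s t u).
have q1 a : limit_arc (fun s => on_arc (q s) a).
  by move=> s t u; rewrite -(qD s t u).
pose h0 y : node limit_graph := exist limit_node _ (q0 y).
pose h1 a : arc limit_graph := exist limit_arc _ (q1 a).
have hs a : src (h1 a) = h0 (src a).
  by apply: eq_exist; apply: functional_extensionality_dep => s /=; apply: hom_src.
have ht a : tgt (h1 a) = h0 (tgt a).
  by apply: eq_exist; apply: functional_extensionality_dep => s /=; apply: hom_tgt.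
exists (GraphHom hs ht); split=> [s|k kq]; first exact: graph_homP.
apply: graph_homP => y /=.
  case ek: (on_node k y) => [x Dx]; apply: eq_exist.
  apply: functional_extensionality_dep => s.
  by rewrite -(kq s) /= ek.
case ek: (on_arc k y) => [x Dx]; apply: eq_exist.
apply: functional_extensionality_dep => s.
by rewrite -(kq s) /= ek.
Qed.

Definition diagram_sum : graph :=
  @Graph {s : S & node (D s)} {s : S & arc (D s)}
    (fun a => existT _ (tag a) (src (tagged a)))
    (fun a => existT _ (tag a) (tgt (tagged a))).

Definition diagram_in (s : S) : graph_hom (D s) diagram_sum :=
  @GraphHom (D s) diagram_sum (existT _ s) (existT _ s)
    (fun=> erefl) (fun=> erefl).

Definition cocone_rel (R0 : node diagram_sum -> node diagram_sum -> Prop)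
    (R1 : arc diagram_sum -> arc diagram_sum -> Prop) : Prop :=
  forall s t (u : fhom s t),
    (forall x, R0 (on_node (diagram_in t) (on_node (Dhom u) x))
                  (on_node (diagram_in s) x)) /\
    (forall a, R1 (on_arc (diagram_in t) (on_arc (Dhom u) a))
                  (on_arc (diagram_in s) a)).

Definition colimit_map := quotient_map (congruence_gen cocone_rel).

Definition colimit_in (s : S) := graph_comp colimit_map (diagram_in s).

Lemma colimit_graphP :
  @is_colimit S Gph D (quotient_graph _ _) colimit_in.
Proof.
split=> [s t u|Y q qD].
  apply: graph_homP => x.
    apply/(classP (congr_node (congruence_gen _))) => R0 R1 _ /(_ s t u)[+ _].
    exact.
  apply/(classP (congr_arc (congruence_gen _))) => R0 R1 _ /(_ s t u)[_].
  exact.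
pose g : graph_hom diagram_sum Y := @GraphHom diagram_sum Y
  (fun x => on_node (q (tag x)) (tagged x))
  (fun a => on_arc (q (tag a)) (tagged a))
  (fun a => hom_src (q (tag a)) _) (fun a => hom_tgt (q (tag a)) _).
(* The kernel of the induced map [g] on the disjoint sum is one of the congruences being
   intersected, so [g] factors through the quotient. *)
have Pg : cocone_rel (fun x y => on_node g x = on_node g y)
                     (fun a b => on_arc g a = on_arc g b).
  by move=> s t u; split=> x /=; rewrite -(qD s t u).
have cg := congruence_kernel g.
have [h hg] := quotient_factor (congruence_gen cocone_rel)
  (fun x y xy => xy _ _ cg Pg) (fun a b ab => ab _ _ cg Pg).
exists h; split=> [s|k kq].
  have -> : q s = graph_comp g (diagram_in s) by apply: graph_homP.
  by rewrite -hg; apply: graph_homP.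
apply: (@quotient_epi _ _ _ (congruence_gen cocone_rel)); rewrite hg.
by apply: graph_homP => -[s x]; rewrite /= -(kq s).
Qed.

End Limits.

(** * Closed walks *)

(* Families of arcs rather than morphisms from the cycle graph are used, since
   the arcs of a cycle determine its nodes. *)
Definition closed_walk (X : graph) n (a : 'I_n -> arc X) : Prop :=
  forall i, src (a i) = tgt (a (ordS i)).

Lemma closed_walk_map (X Y : graph) (f : graph_hom X Y) n (a : 'I_n -> arc X) :
  closed_walk a -> closed_walk (on_arc f \o a).
Proof. by move=> wa i; rewrite /= hom_src hom_tgt wa. Qed.

Definition lifts_closed_walks (X Y : graph) (f : graph_hom X Y) : Prop :=
  forall n (a : 'I_n -> arc Y), closed_walk a ->
    exists! b : 'I_n -> arc X, closed_walk b /\ on_arc f \o b = a.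

Definition cycle_hom (X : graph) n (a : 'I_n -> arc X) (wa : closed_walk a) :
    graph_hom (cycle_graph n) X :=
  @GraphHom (cycle_graph n) X (fun i => tgt (a i)) a wa (fun=> erefl).

Lemma closed_walk_cycle (X : graph) n (c : graph_hom (cycle_graph n) X) :
  closed_walk (on_arc c).
Proof. by move=> i; rewrite hom_src hom_tgt. Qed.

Lemma cycle_hom_eq (X : graph) n (c d : graph_hom (cycle_graph n) X) :
  on_arc c =1 on_arc d -> c = d.
Proof. by move=> e; apply: graph_homP => // i; rewrite -!hom_tgt e. Qed.

Lemma from_emptyP (X : graph) (f : graph_hom empty_graph X) : f = from_empty X.
Proof. by apply: graph_homP => -[]. Qed.

Definition copair (X Y Z : graph) (f : graph_hom X Z) (g : graph_hom Y Z) :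
    graph_hom (sum_graph X Y) Z :=
  @GraphHom (sum_graph X Y) Z
    (fun x => match x with inl y => on_node f y | inr y => on_node g y end)
    (fun a => match a with inl b => on_arc f b | inr b => on_arc g b end)
    (fun a => match a with inl b => hom_src f b | inr b => hom_src g b end)
    (fun a => match a with inl b => hom_tgt f b | inr b => hom_tgt g b end).

Definition sum_inl (X Y : graph) : graph_hom X (sum_graph X Y) :=
  @GraphHom X (sum_graph X Y) inl inl (fun=> erefl) (fun=> erefl).

Definition sum_inr (X Y : graph) : graph_hom Y (sum_graph X Y) :=
  @GraphHom Y (sum_graph X Y) inr inr (fun=> erefl) (fun=> erefl).

(** Lifting against [mor_i n] is existence of a lift of each closed walk, and lifting against
    [mor_j n] is its uniqueness: two lifts of one walk form a map out of two copies of the cycle,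
    and a filler makes them agree. *)
Lemma rlp_gen_KP (X Y : graph) (f : graph_hom X Y) :
  rlp gen_K (Arrow (f : @hom Gph X Y)) <-> lifts_closed_walks f.
Proof.
split=> [Kf n a wa|Wf _ [n [n_gt0 [->|->]]] u v /= e].
(* Length zero is covered by no generator, but there is exactly one family on the empty ['I_0]. *)
- case: n => [|n] in a wa *.
    have b : 'I_0 -> arc X by case.
    by exists b; split=> [|c _]; [split=> [[]//|]|]; apply: funext => -[].
  have Kfi : lifts (Arrow (mor_i n.+1)) (Arrow (f : @hom Gph X Y)).
    by apply: Kf; exists n.+1; split=> //; left.
  have Kfj : lifts (Arrow (mor_j n.+1)) (Arrow (f : @hom Gph X Y)).
    by apply: Kf; exists n.+1; split=> //; right.
  have [|h [_ fh]] := Kfi (from_empty X) (cycle_hom wa).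
    by rewrite [LHS]from_emptyP [RHS]from_emptyP.
  exists (on_arc h); split=> [|b [wb fb]].
    split; first exact: closed_walk_cycle.
    by apply: funext => i; rewrite -[a]/(on_arc (cycle_hom wa)) -fh.
  have [|k [kj fk]] := Kfj (copair h (cycle_hom wb)) (cycle_hom wa).
    have fhE : graph_comp f h = cycle_hom wa by [].
    have fbE : graph_comp f (cycle_hom wb) = cycle_hom wa.
      by apply: cycle_hom_eq => i; rewrite /= -fb.
    apply: graph_homP => -[] i /=.
    + by rewrite -[LHS]/(on_node (graph_comp f h) i) fhE.
    + by rewrite -[LHS]/(on_node (graph_comp f (cycle_hom wb)) i) fbE.
    + by rewrite -[LHS]/(on_arc (graph_comp f h) i) fhE.
    + by rewrite -[LHS]/(on_arc (graph_comp f (cycle_hom wb)) i) fbE.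
  apply: funext => i.
  transitivity (on_arc k i).
    exact: esym (on_arc_eq kj (inl i)).
  exact: (on_arc_eq kj (inr i)).
- have [b [[wb fb] _]] := Wf _ _ (closed_walk_cycle v).
  exists (cycle_hom wb); split; first by rewrite [LHS]from_emptyP [RHS]from_emptyP.
  by apply: cycle_hom_eq => i; rewrite /= -fb.
(* The two halves of [u] lift the same closed walk, so both equal its unique lift [b]. *)
have [b [[wb fb] b_uniq]] := Wf _ _ (closed_walk_cycle v).
pose ul := graph_comp u (sum_inl _ _); pose ur := graph_comp u (sum_inr _ _).
have bl : b = on_arc ul.
  apply: b_uniq; split; first exact: closed_walk_cycle.
  apply: funext => i.
  exact: (on_arc_eq e (inl i)).
have br : b = on_arc ur.
  apply: b_uniq; split; first exact: closed_walk_cycle.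
  apply: funext => i.
  exact: (on_arc_eq e (inr i)).
have blE : cycle_hom wb = ul by apply: cycle_hom_eq => i; rewrite /= bl.
have brE : cycle_hom wb = ur by apply: cycle_hom_eq => i; rewrite /= br.
exists (cycle_hom wb); split; last first.
  by apply: cycle_hom_eq => i; rewrite /= -fb.
apply: graph_homP => -[] i.
- exact: (on_node_eq blE i).
- exact: (on_node_eq brE i).
- exact: (on_arc_eq blE i).
- exact: (on_arc_eq brE i).
Qed.

Lemma lifts_closed_walks_inj (X Y : graph) (f : graph_hom X Y) n
    (b c : 'I_n -> arc X) : lifts_closed_walks f ->
  closed_walk b -> closed_walk c -> on_arc f \o b = on_arc f \o c -> b = c.
Proof.
move=> Wf wb wc e; have [d [_ d_uniq]] := Wf n _ (closed_walk_map f wb).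
by rewrite -(d_uniq b) // -(d_uniq c).
Qed.

(** Membership means inducing a bijection on closed walks of each length, and bijections satisfy
    two-of-three. *)
Lemma two_of_three_rlp_gen_K : two_of_three (rlp gen_K).
Proof.
split=> X Y Z a b /rlp_gen_KP W1 /rlp_gen_KP W2; apply/rlp_gen_KP => n z wz.
- have [y [[wy ay] _]] := W1 n z wz; have [x [[wx bx] _]] := W2 n y wy.
  exists x; split=> [|x' [wx' abx']]; first by split; rewrite // -ay -bx.
  apply: (lifts_closed_walks_inj W2) => //.
  apply: (lifts_closed_walks_inj W1); try exact: closed_walk_map.
  by rewrite bx ay -abx'.
- have [x [[wx abx] x_uniq]] := W2 n z wz.
  exists (on_arc b \o x); split=> [|y [wy ay]].
    by split; [exact: closed_walk_map|rewrite -abx].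
  (* A competing walk [y] over [z] comes from a walk of the source of [b], where uniqueness over the
     composite applies. *)
  have [x' [[wx' bx'] _]] := W1 n y wy.
  by rewrite -bx'; congr (_ \o _); apply: x_uniq; split; rewrite // -ay -bx'.
have waz := closed_walk_map a wz.
have [x [[wx abx] x_uniq]] := W2 n _ waz.
exists x; split=> [|x' [wx' bx']].
  split=> //; apply: (lifts_closed_walks_inj W1) => //.
  exact: closed_walk_map.
by apply: x_uniq; split; rewrite // -bx'.
Qed.

(** * The factorization generated by J *)

(** A square on [mor_s] amounts to a node of [X] with an arc of [Y] leaving its image; a filler is
    an arc above it that leaves the node. *)
Lemma rlp_gen_JP (X Y : graph) (f : graph_hom X Y) :
  rlp gen_J (Arrow (f : @hom Gph X Y)) <->
  forall x a, on_node f x = src a -> exists2 b, src b = x & on_arc f b = a.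
Proof.
split=> [Jf x a e|Ff _ -> u v /= e].
  pose u : graph_hom graph_D X := @GraphHom graph_D X (fun=> x)
    (fun a : void => match a with end) (fun a : void => match a with end)
    (fun a : void => match a with end).
  pose v : graph_hom graph_A Y := @GraphHom graph_A Y
    (fun i => if i then tgt a else src a) (fun=> a) (fun=> erefl) (fun=> erefl).
  have [|h [hs fh]] := Jf _ erefl u v; first by apply: graph_homP => -[].
  exists (on_arc h tt).
    rewrite hom_src.
    exact: (on_node_eq hs tt).
  exact: (on_arc_eq fh tt).
have [|b bu fb] := Ff (on_node u tt) (on_arc v tt).
  rewrite hom_src.
  exact: (on_node_eq e tt).
pose h : graph_hom graph_A X := @GraphHom graph_A X
  (fun i => if i then tgt b else src b) (fun=> b) (fun=> erefl) (fun=> erefl).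
exists h; split; first by apply: graph_homP => -[].
apply: graph_homP => [[]|[]] //=.
  by rewrite -hom_tgt fb hom_tgt.
by rewrite -hom_src fb hom_src.
Qed.

Section Whiskers.
Variables (X Y : graph) (f : graph_hom X Y).

(* Paths in Y that start at the image of a node of X, indexed by their end. *)
Inductive whisker : node Y -> Type :=
| Root x : whisker (on_node f x)
| Grow a : whisker (src a) -> whisker (tgt a).

(** At each node of [X] this plants the tree of all paths of [Y] leaving its image, even where [X]
    already has lifts. An added arc is given by the whisker at its source and the arc of [Y] below
    it. *)
Definition whisker_graph : graph :=
  @Graph {y : node Y & whisker y} (arc X + {a : arc Y & whisker (src a)})%type
    (fun e => match e with
      | inl a => existT whisker _ (Root (src a))
      | inr w => existT whisker _ (tagged w) end)
    (fun e => match e with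
      | inl a => existT whisker _ (Root (tgt a))
      | inr w => existT whisker _ (Grow (tagged w)) end).

Definition whisker_in : graph_hom X whisker_graph :=
  @GraphHom X whisker_graph (fun x => existT whisker _ (Root x)) inl
    (fun=> erefl) (fun=> erefl).

Definition whisker_end : graph_hom whisker_graph Y :=
  @GraphHom whisker_graph Y (fun w => tag w)
    (fun e => match e with inl a => on_arc f a | inr w => tag w end)
    (fun e => match e with inl a => hom_src f a | inr w => erefl end)
    (fun e => match e with inl a => hom_tgt f a | inr w => erefl end).

Lemma whisker_endK : graph_comp whisker_end whisker_in = f.
Proof. exact: graph_homP. Qed.

Lemma rlp_whisker_end :
  rlp gen_J (Arrow (whisker_end : @hom Gph whisker_graph Y)).
Proof.
apply/rlp_gen_JP => -[y w] a /= e; subst y.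
by exists (inr (existT (fun a => whisker (src a)) a w)).
Qed.

(** A filler is built by recursion along the trees, choosing at each [Grow] an arc of [B] that lifts
    the required one. *)
Lemma llp_whisker_in :
  llp (rlp gen_J) (Arrow (whisker_in : @hom Gph X whisker_graph)).
Proof.
move=> [B C p] /rlp_gen_JP Fp u v /= e.
pose growth a w : arc whisker_graph :=
  inr (existT (fun a => whisker (src a)) a w).
have grow a (w : whisker (src a)) (x : node B) :
    on_node p x = on_node v (existT whisker _ w) ->
    {b : arc B | src b = x /\ on_arc p b = on_arc v (growth a w)}.
  move=> px; apply: cid; have [|b] := Fp x (on_arc v (growth a w)).
    by rewrite px hom_src.
  by exists b.
have grow_tgt a (w : whisker (src a)) x (px : on_node p x = _) :
    on_node p (tgt (sval (grow a w x px))) =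
    on_node v (existT whisker _ (Grow w)).
  by case: (grow a w x px) => b /= [_ pb]; rewrite -hom_tgt pb hom_tgt.
(* The value carries the proof that it lies over [v], because the next choice by [grow] needs it. *)
pose fix h y (w : whisker y) :
    {x : node B | on_node p x = on_node v (existT whisker y w)} :=
  match w in whisker y
    return {x : node B | on_node p x = on_node v (existT whisker y w)} with
  | Root x => exist _ (on_node u x) (on_node_eq e x)
  | Grow a w => exist _ _ (grow_tgt a w _ (svalP (h _ w))) end.
pose h0 (w : node whisker_graph) := sval (h (tag w) (tagged w)).
(* An added arc goes to the very arc chosen in [h], so that its target is right by computation. *)
pose h1 (c : arc whisker_graph) := match c with
  | inl a => on_arc u a
  | inr w => sval (grow _ _ _ (svalP (h _ (tagged w)))) end.
have hs c : src (h1 c) = h0 (src c).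
  case: c => [a|[a w]]; first exact: hom_src.
  by rewrite /h1; case: (grow _ _ _ _) => b [].
have ht c : tgt (h1 c) = h0 (tgt c) by case: c => [a|[a w]] //; apply: hom_tgt.
exists (GraphHom hs ht); split; first exact: graph_homP.
apply: graph_homP => [[y w]|[a|[a w]]].
- exact: (svalP (h y w)).
- exact: (on_arc_eq e a).
by rewrite /= /h1; case: (grow _ _ _ _) => b [].
Qed.

Fixpoint depth y (w : whisker y) : nat :=
  match w with Root _ => 0 | Grow _ w => (depth w).+1 end.

Fixpoint root y (w : whisker y) : node X :=
  match w with Root x => x | Grow _ w => root w end.

(* The depth strictly increases along the added arcs and vanishes at both ends
   of the other ones, so a closed walk has no node of maximal positive depth. *)
Lemma whisker_closed_walk n (a : 'I_n -> arc whisker_graph) :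
  closed_walk a -> forall i, exists b, inl b = a i.
Proof.
move=> wa; pose d i := depth (tagged (tgt (a i))).
(* Arc [i] of a cycle runs from node [i + 1] to node [i], so [d (ordS i)] is the depth at the source
   of [a i]. *)
have dE i : (exists b, inl b = a i) /\ d (ordS i) = 0 \/ d i = (d (ordS i)).+1.
  rewrite {1 3}/d -wa /d; case: (a i) => [b|w]; last by right.
  by left; split; [exists b|].
have d0 i : d i = 0.
  (* At the predecessor of a maximizer [k], [dE] gives either [d k = 0] or a depth exceeding the
     maximum. *)
  have [k _ dk] := @arg_maxnP _ i predT d isT; apply/eqP.
  rewrite -leqn0 (leq_trans (dk i isT)) // leqn0; apply/eqP.
  have [[_]|] := dE (ord_pred k); rewrite ord_predK // => e.
  by have := dk (ord_pred k) isT; rewrite /= e ltnn.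
by move=> i; have [[]|] := dE i; rewrite ?d0.
Qed.

(** Closed walks use only arcs of [X], on which [whisker_in] is injective. *)
Lemma lifts_closed_walks_whisker_in : lifts_closed_walks whisker_in.
Proof.
move=> n a wa; have /choice[b ab] := whisker_closed_walk wa.
exists b; split=> [|c [_ ca]].
  split; last by apply: funext.
  move=> i; have := wa i; rewrite -!ab.
  (* Applying [root] extracts the equality of nodes of [X] from an equality of dependent pairs. *)
  by move/(congr1 (fun w : node whisker_graph => root (tagged w))).
by apply: funext => i; have := ab i; rewrite -ca => -[].
Qed.

End Whiskers.

Lemma factors_gen_J :
  @factors Gph (cap_class (llp (rlp gen_J)) (rlp gen_K)) (rlp gen_J).
Proof.
move=> X Y f; exists (whisker_graph f), (whisker_in f), (whisker_end f); split.
- split; first exact: llp_whisker_in.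
  exact/rlp_gen_KP/lifts_closed_walks_whisker_in.
- exact: rlp_whisker_end.
by rewrite [RHS]whisker_endK.
Qed.

(** * The factorization generated by K *)

Section Cycles.
Variables (X Y : graph) (f : graph_hom X Y).

Definition cycle_index := {n : nat & {a : 'I_n -> arc Y | closed_walk a}}.

Definition index_hom (c : cycle_index) : graph_hom (cycle_graph (tag c)) Y :=
  cycle_hom (svalP (tagged c)).

(** One type serves for both nodes and arcs of the added cycles, since a cycle graph has ['I_n] as
    both. Empty walks contribute no point. *)
Definition cycle_point := {c : cycle_index & 'I_(tag c)}.

Definition cycle_at (c : cycle_index) (i : 'I_(tag c)) : cycle_point :=
  existT (fun c : cycle_index => 'I_(tag c)) c i.

Definition adjoin_cycles : graph :=
  @Graph (node X + cycle_point)%type (arc X + cycle_point)%type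
    (fun e => match e with
      | inl a => inl (src a) | inr c => inr (cycle_at (ordS (tagged c))) end)
    (fun e => match e with inl a => inl (tgt a) | inr c => inr c end).

Definition adjoin_in : graph_hom X adjoin_cycles :=
  @GraphHom X adjoin_cycles inl inl (fun=> erefl) (fun=> erefl).

Section Copairing.
Variables (Z : graph) (u : graph_hom X Z).
Variable g : forall c : cycle_index, graph_hom (cycle_graph (tag c)) Z.

Definition adjoin_copair : graph_hom adjoin_cycles Z :=
  @GraphHom adjoin_cycles Z
    (fun x => match x with
      | inl y => on_node u y | inr c => on_node (g (tag c)) (tagged c) end)
    (fun e => match e with
      | inl a => on_arc u a | inr c => on_arc (g (tag c)) (tagged c) end)
    (fun e => match e with
      | inl a => hom_src u a | inr c => hom_src (g (tag c)) (tagged c) end)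
    (fun e => match e with
      | inl a => hom_tgt u a | inr c => hom_tgt (g (tag c)) (tagged c) end).

End Copairing.

Definition adjoin_out := adjoin_copair f index_hom.

(* The families [a] and [b] represent closed walks of the quotient graph. *)
Definition identifies_cycles
    (R0 : node adjoin_cycles -> node adjoin_cycles -> Prop)
    (R1 : arc adjoin_cycles -> arc adjoin_cycles -> Prop) : Prop :=
  forall n (a b : 'I_n -> arc adjoin_cycles),
    (forall i, R0 (src (a i)) (tgt (a (ordS i)))) ->
    (forall i, R0 (src (b i)) (tgt (b (ordS i)))) ->
    on_arc adjoin_out \o a = on_arc adjoin_out \o b ->
    forall i, R1 (a i) (b i).

Let E0 := gen_node identifies_cycles.
Let E1 := gen_arc identifies_cycles.
Let congE : congruence E0 E1 := congruence_gen identifies_cycles.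

(** A family closed modulo the intersection is closed modulo each congruence being intersected, so
    the condition passes to the intersection. *)
Lemma identifies_cycles_gen : identifies_cycles E0 E1.
Proof.
move=> n a b wa wb e i R0 R1 cR PR; apply: (PR n a b) => // j.
  exact: wa cR PR.
exact: wb cR PR.
Qed.

Definition collapse := quotient_map congE.

Lemma collapse_factor : exists r : graph_hom (quotient_graph E0 E1) Y,
  graph_comp r collapse = adjoin_out.
Proof.
have ck := congruence_kernel adjoin_out.
have Pk : identifies_cycles (fun x y => on_node adjoin_out x = on_node adjoin_out y)
    (fun a b => on_arc adjoin_out a = on_arc adjoin_out b).
  by move=> n a b _ _ e i; apply: (congr1 (fun h => h i) e).
apply: quotient_factor => x y xy; exact: (xy _ _ ck Pk).
Qed.

(** Existence comes from the cycle adjoined for the given walk. Uniqueness holds because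
    representatives of two lifts are closed modulo [E0] with the same image in [Y], and hence are
    identified. *)
Lemma lifts_collapse (r : graph_hom (quotient_graph E0 E1) Y) :
  graph_comp r collapse = adjoin_out -> lifts_closed_walks r.
Proof.
move=> rE n a wa.
have rE1 z : on_arc adjoin_out (repr z) = on_arc r z.
  by rewrite -rE /= reprK.
have repr_walk (b : 'I_n -> arc (quotient_graph E0 E1)) : closed_walk b ->
    forall i, E0 (src (repr (b i))) (tgt (repr (b (ordS i)))).
  move=> wb i; apply/(classP (congr_node congE)).
  exact: wb.
pose c : cycle_index := existT _ n (exist (@closed_walk Y n) a wa).
pose b := on_arc collapse \o (fun i : 'I_n => inr (@cycle_at c i)).
have wb : closed_walk b by apply: closed_walk_map.
have rb : on_arc r \o b = a.
  apply: funext => i.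
  exact: (on_arc_eq rE (inr (@cycle_at c i))).
exists b; split=> // d [wd rd].
apply: funext => i; rewrite -[b i]reprK -[d i]reprK.
apply/(classP (congr_arc congE)).
apply: (identifies_cycles_gen (repr_walk b wb) (repr_walk d wd)).
apply: funext => j; apply: (etrans (rE1 _)); apply: (etrans _ (esym (rE1 _))).
have rbd : on_arc r \o b = on_arc r \o d by rewrite rb rd.
exact: (congr1 (fun h => h j) rbd).
Qed.

Lemma llp_collapse :
  llp (rlp gen_K) (Arrow
    (graph_comp collapse adjoin_in : @hom Gph X (quotient_graph E0 E1))).
Proof.
move=> [B C p] /rlp_gen_KP Wp u v /= e.
(* The image under [v] of each adjoined cycle is lifted through [p]; these lifts and [u] together
   define [g]. *)
have lift c : exists k : graph_hom (cycle_graph (tag c)) B, forall i,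
    on_arc p (on_arc k i) = on_arc v (class E1 (inr (@cycle_at c i))).
  pose a := on_arc (graph_comp v collapse) \o (fun i => inr (@cycle_at c i)).
  have wa : closed_walk a by apply: closed_walk_map.
  have [b [[wb pb] _]] := Wp _ a wa.
  by exists (cycle_hom wb) => i; rewrite -[RHS]/(a i) -pb.
pose k c := projT1 (cid (lift c)).
have pk c i : on_arc p (on_arc (k c) i) = on_arc v (class E1 (inr (@cycle_at c i))).
  exact: projT2 (cid (lift c)) i.
pose g := adjoin_copair u k.
have pg : graph_comp p g = graph_comp v collapse.
  apply: graph_homP => -[x|[c i]].
  - exact: (on_node_eq e x).
  (* Node [i] of a cycle is the target of arc [i], which reduces this case to arcs. *)
  - transitivity (tgt (on_arc p (on_arc (k c) i))); first by rewrite !hom_tgt.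
    by rewrite (pk c i) hom_tgt (class_tgt congE).
  - exact: (on_arc_eq e x).
  exact: pk.
(* Closedness modulo the kernel of [g] alone would not give equal images under [v]. Intersecting
   with the least congruence does: the walks are then identified by [E1], and unique lifting along
   [p] equates their images under [g]. Minimality puts [E0] and [E1] inside [G0] and [G1]. *)
pose G0 x y := E0 x y /\ on_node g x = on_node g y.
pose G1 a b := E1 a b /\ on_arc g a = on_arc g b.
have cG : congruence G0 G1 := congruenceI congE (congruence_kernel g).
have PG : identifies_cycles G0 G1.
  move=> n a b wa wb ab.
  have Eab i : E1 (a i) (b i).
    by apply: identifies_cycles_gen => // j; [case: (wa j)|case: (wb j)].
  have gab : on_arc g \o a = on_arc g \o b.
    apply: (lifts_closed_walks_inj Wp).
    - by move=> i; apply: (etrans (hom_src g _)); rewrite (proj2 (wa i)) -hom_tgt.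
    - by move=> i; apply: (etrans (hom_src g _)); rewrite (proj2 (wb i)) -hom_tgt.
    apply: funext => i.
    transitivity (on_arc v (class E1 (a i))); first exact: (on_arc_eq pg (a i)).
    transitivity (on_arc v (class E1 (b i))); last exact: esym (on_arc_eq pg (b i)).
    by congr on_arc; apply/(classP (congr_arc congE)).
  by move=> i; split=> //; apply: (congr1 (fun h => h i) gab).
have [h hg] := quotient_factor congE (g := g)
  (fun x y xy => proj2 (xy _ _ cG PG)) (fun a b ab => proj2 (ab _ _ cG PG)).
exists h; split.
  have -> : u = graph_comp g adjoin_in by apply: graph_homP.
  by rewrite -hg; apply: graph_homP.
by apply: (quotient_epi (congR := congE)); rewrite -pg -hg; apply: graph_homP.
Qed.

End Cycles.

Lemma factors_gen_K : @factors Gph (llp (rlp gen_K)) (rlp gen_K).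
Proof.
move=> X Y f; have [r rE] := collapse_factor f.
exists (quotient_graph _ _), (graph_comp (collapse f) (adjoin_in X Y)), r.
split; first exact: llp_collapse.
  exact/rlp_gen_KP/(lifts_collapse rE).
transitivity (graph_comp (adjoin_out f) (adjoin_in X Y)); first exact: graph_homP.
by rewrite -rE; apply: graph_homP.
Qed.

Theorem mainTheorem5 :
  exists Cof W Fib : arrow_class Gph,
    [/\ is_model_structure Cof W Fib,
        cofibrantly_generated gen_I gen_J W Fib &
        eq_class W (rlp gen_K)].
Proof.
exists (llp (rlp gen_I)), (rlp gen_K), (rlp gen_J); split=> //.
  apply: model_structure_of_rlp.
  - by move=> S D; exists (limit_graph D), (@limit_proj S D); apply: limit_graphP.
  - by move=> S D; eexists; exists (@colimit_in S D); apply: colimit_graphP.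
  - exact: two_of_three_rlp_gen_K.
  - exact: factors_gen_J.
  exact: factors_gen_K.
split=> //; last exact: rlp_cup.
  (* The shift to [n.+1] excludes length zero, and the boolean selects [mor_i] or [mor_j]. *)
  pose gen (c : option (nat * bool)) : arrow Gph := match c with
    | None => Arrow mor_s
    | Some (n, true) => Arrow (mor_i n.+1)
    | Some (n, false) => Arrow (mor_j n.+1) end.
  exists (option (nat * bool)), gen => a; split.
    case=> [->|[[|n] [n_gt0 [->|->]]]] //.
    - by exists None.
    - by exists (Some (n, true)).
    by exists (Some (n, false)).
  case=> -[[n b]|] <-; last by left.
  by right; exists n.+1; split=> //; case: b; [left|right].
by exists unit, (fun=> Arrow mor_s) => a; split=> [->|[_ <-]] //; exists tt.
Qed.
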